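(* The map $\Delta:A_2(0)\to A_2(0)\otimes A_2(0)$ given on the generators by $$\Delta(z_{i,j})=\sum_{k=\min\{i,j\}}^{\max\{i,j\}}z_{i,k}\otimes z_{k,j},\qquad 1\le i,j\le 3,$$ together with the $*$-homomorphism $\epsilon:A_2(0)\to\mathbb C$ given by $\epsilon(z_{i,j})=\delta_{i,j}$, makes $(A_2(0),\Delta,\epsilon)$ a $C^*$-bialgebra. That is, $\Delta$ extends to a unital $*$-homomorphism, $(\Delta\otimes\mathrm{id})\Delta=(\mathrm{id}\otimes\Delta)\Delta$, and $(\epsilon\otimes\mathrm{id})\Delta=(\mathrm{id}\otimes\epsilon)\Delta=\mathrm{id}$.
   Context: **The $C^*$-algebra $A_2(0)$.** It is the universal unital $C^*$-algebra generated by $z_{i,j}$, $1\le i,j\le 3$, subject to the relations: $z_{i,j}z_{i,l}=0$ if $j<l$; $z_{i,j}z_{k,j}=0$ if $i<k$; $z_{i,l}z_{k,j}=z_{k,j}z_{i,l}$ if $i<k$, $j<l$; $z_{i,l}z_{k,j}=0$ if $i<k$, $j<l$, $\max\{i,j\}\ge\min\{k,l\}$; $z_{i,j}z_{k,l}=z_{k,l}z_{i,j}$ if $i<k$, $j<l$, $\max\{i,j\}+1<\min\{k,l\}$; $z_{i,j}z_{k,l}-z_{k,l}z_{i,j}=z_{i,l}z_{k,j}$ if $i<k$, $j<l$, $\max\{i,j\}+1=\min\{k,l\}$; $z_{1,1}z_{2,2}z_{3,3}=1$; $z_{1,1}^*=z_{2,2}z_{3,3}$, $z_{2,2}^*=z_{1,1}z_{3,3}$,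 $z_{3,3}^*=z_{1,1}z_{2,2}$, $z_{2,1}^*=z_{1,2}z_{3,3}$, $z_{3,2}^*=z_{1,1}z_{2,3}$, $z_{3,1}^*=z_{1,2}z_{2,3}$, $z_{1,2}^*=z_{2,1}z_{3,3}$, $z_{2,3}^*=z_{1,1}z_{3,2}$, $z_{1,3}^*=z_{2,1}z_{3,2}$; $z_{i,j}^*z_{r,s}=z_{r,s}z_{i,j}^*$ if $i\ne r$, $j\ne s$. The tensor product is the $C^*$-algebraic tensor product (it is unique since $A_2(0)$ is of type I). In the paper $\epsilon$ is denoted $\psi_{(1,1),\mathrm{id}}$, the one-dimensional representation $z_{i,j}\mapsto\delta_{i,j}$. *)

(* Defs.v *)
From HB Require Import structures.
From mathcomp Require Import all_boot all_order all_algebra complex.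
From mathcomp Require Import reals.

Set Implicit Arguments.
Unset Strict Implicit.
Unset Printing Implicit Defensive.

Import Order.TTheory GRing.Theory Num.Theory.
Import ComplexField.Normc.

Local Open Scope ring_scope.
Local Open Scope complex_scope.

(* Algebras are unital, and nonzero since algType requires 1 != 0. *)
HB.mixin Record isStarAlgebra (R : realType) A of GRing.Algebra R[i] A := {
  star : A -> A;
  starK : involutive star;
  starD : {morph star : x y / x + y};
  starZ : forall (c : R[i]) (x : A), star (c *: x) = conjc c *: star x;
  starM : forall x y : A, star (x * y) = star y * star x
}.

#[short(type="starAlgType")]
HB.structure Definition StarAlgebra (R : realType) :=
  {A of GRing.Algebra R[i] A & isStarAlgebra R A}.

(* The norm is R-valued and carried by a mixin of its own, with the notions of
   Cauchy and convergent sequence spelled out: the classes of rings and of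
   normed modules of the library have no join other than numDomainType, and HB
   does not allow one to be inserted below it. *)
HB.mixin Record StarAlgebra_isCstar (R : realType) A of StarAlgebra R A := {
  cnorm : A -> R;
  cnorm_ge0 : forall x : A, 0 <= cnorm x;
  cnorm_eq0 : forall x : A, cnorm x = 0 -> x = 0;
  cnormD : forall x y : A, cnorm (x + y) <= cnorm x + cnorm y;
  cnormZ : forall (c : R[i]) (x : A), cnorm (c *: x) = normc c * cnorm x;
  cnormM : forall x y : A, cnorm (x * y) <= cnorm x * cnorm y;
  cnorm_cstar : forall x : A, cnorm (star x * x) = cnorm x ^+ 2;
  cnorm_complete : forall u : nat -> A,
    (forall e : R, 0 < e -> exists N : nat, forall m n : nat,
       (N <= m)%N -> (N <= n)%N -> cnorm (u m - u n) < e) ->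
    exists l : A, forall e : R, 0 < e -> exists N : nat, forall n : nat,
       (N <= n)%N -> cnorm (u n - l) < e
}.

#[short(type="cstarAlgType")]
HB.structure Definition CstarAlgebra (R : realType) :=
  {A of StarAlgebra R A & StarAlgebra_isCstar R A}.

Section ComplexStar.
Variable R : realType.

Lemma conj_scale (c : R[i]) (x : R[i]^o) :
  conjc (c *: x) = conjc c *: (conjc (x : R[i]) : R[i]^o).
Proof. exact: rmorphM. Qed.

Lemma conj_mulC (x y : R[i]^o) :
  conjc (x * y) = conjc (y : R[i]) * conjc (x : R[i]).
Proof. by rewrite rmorphM mulrC. Qed.

HB.instance Definition _ := isStarAlgebra.Build R R[i]^o
  (@conjcK R) (rmorphD (@conjc R)) conj_scale conj_mulC.

End ComplexStar.

(* Unital *-homomorphisms. No continuity is imposed: between C*-algebras it is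
   automatic. *)

Definition star_hom (R : realType) (A B : starAlgType R) (f : A -> B) : Prop :=
  [/\ linear f, monoid_morphism f & {morph f : x / star x}].

Section Tensor.
Variable R : realType.

Definition lin_indep (V : lmodType R[i]) (n : nat) (v : 'I_n -> V) : Prop :=
  forall c : 'I_n -> R[i], \sum_i c i *: v i = 0 -> forall i, c i = 0.

(* [t] identifies the algebraic tensor product of A and B, with its usual
   *-algebra structure, with a *-subalgebra of T: [t a b] is the elementary
   tensor of a and b, and the last clause is the injectivity of the induced
   linear map from the algebraic tensor product to T. *)
Definition alg_tensor (A B T : starAlgType R) (t : A -> B -> T) : Prop :=
  [/\ (forall b, linear (t^~ b)) /\ (forall a, linear (t a)),
      t 1 1 = 1,
      forall a a' b b', t a b * t a' b' = t (a * a') (b * b'),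
      forall a b, star (t a b) = t (star a) (star b)
    & forall n (a : 'I_n -> A) (b : 'I_n -> B),
        lin_indep b -> \sum_i t (a i) (b i) = 0 -> forall i, a i = 0].

(* T is the completion of the algebraic tensor product in the greatest C*-norm,
   i.e. in the norm
     sup { || \sum_i f (a i) * g (b i) || : (f, g) unital *-homomorphisms from
            A and B into a C*-algebra, with commuting ranges };
   the supremum is reached by the pair (t^~ 1, t 1) itself. When A or B is of
   type I (or just nuclear), this is the only C*-norm on the algebraic tensor
   product. *)
Definition cstar_tensor (A B T : cstarAlgType R) (t : A -> B -> T) : Prop :=
  [/\ alg_tensor t,
      forall (x : T) (e : R), 0 < e ->
        exists n (a : 'I_n -> A) (b : 'I_n -> B),
          cnorm (x - \sum_i t (a i) (b i)) < e
    & forall (C : cstarAlgType R) (f : A -> C) (g : B -> C),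
        star_hom f -> star_hom g -> (forall a b, f a * g b = g b * f a) ->
        forall n (a : 'I_n -> A) (b : 'I_n -> B),
          cnorm (\sum_i f (a i) * g (b i)) <= cnorm (\sum_i t (a i) (b i))].

Record cstarTensor (A B : cstarAlgType R) := CstarTensor {
  tensor_alg :> cstarAlgType R;
  tensor : A -> B -> tensor_alg;
  tensorP : cstar_tensor tensor
}.

(* [h] is the *-homomorphism usually written f \otimes g. *)
Definition tensor_hom (A B A' B' : cstarAlgType R)
    (T : cstarTensor A B) (T' : cstarTensor A' B')
    (f : A -> A') (g : B -> B') (h : T -> T') : Prop :=
  star_hom h /\ forall a b, h (tensor T a b) = tensor T' (f a) (g b).

(* [h] is the canonical isomorphism
   (A \otimes A) \otimes A ~ A \otimes (A \otimes A). *)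
Definition tensor_assoc (A : cstarAlgType R) (T : cstarTensor A A)
    (TL : cstarTensor T A) (TR : cstarTensor A T) (h : TL -> TR) : Prop :=
  [/\ star_hom h, bijective h
    & forall a b c, h (tensor TL (tensor T a b) c)
                    = tensor TR a (tensor T b c)].

(* [l] and [r] are e \otimes id and id \otimes e, followed by the canonical
   isomorphisms of C \otimes A and A \otimes C with A. *)
Definition counit_left (A : cstarAlgType R) (T : cstarTensor A A)
    (e : A -> R[i]^o) (l : T -> A) : Prop :=
  star_hom l /\ forall a b, l (tensor T a b) = (e a : R[i]) *: b.

Definition counit_right (A : cstarAlgType R) (T : cstarTensor A A)
    (e : A -> R[i]^o) (r : T -> A) : Prop :=
  star_hom r /\ forall a b, r (tensor T a b) = (e b : R[i]) *: a.

Definition cstar_bialgebra (A : cstarAlgType R) (T : cstarTensor A A)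
    (TL : cstarTensor T A) (TR : cstarTensor A T)
    (D : A -> T) (e : A -> R[i]^o) : Prop :=
  [/\ star_hom D,
      star_hom e,
      exists (DL : T -> TL) (DR : T -> TR) (h : TL -> TR),
        [/\ tensor_hom D id DL, tensor_hom id D DR, tensor_assoc h
          & forall x, h (DL (D x)) = DR (D x)]
    & exists (l r : T -> A),
        [/\ counit_left e l, counit_right e r,
            forall x, l (D x) = x & forall x, r (D x) = x]].

End Tensor.

(* Indices are shifted by one: 'I_3 = {0, 1, 2} stands for {1, 2, 3}. The
   relations on general indices only compare indices with each other, so they
   are insensitive to the shift. *)

Definition i1 : 'I_3 := @Ordinal 3 0 isT.
Definition i2 : 'I_3 := @Ordinal 3 1 isT.
Definition i3 : 'I_3 := @Ordinal 3 2 isT.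

Section A20.
Variable R : realType.

Record A20_relations (B : starAlgType R) (z : 'I_3 -> 'I_3 -> B) : Prop :=
  A20Relations {
  A20_row : forall i j l : 'I_3, (j < l)%N -> z i j * z i l = 0;
  A20_col : forall i j k : 'I_3, (i < k)%N -> z i j * z k j = 0;
  A20_cross : forall i j k l : 'I_3, (i < k)%N -> (j < l)%N ->
    z i l * z k j = z k j * z i l;
  A20_cross0 : forall i j k l : 'I_3, (i < k)%N -> (j < l)%N ->
    (minn k l <= maxn i j)%N -> z i l * z k j = 0;
  A20_diag : forall i j k l : 'I_3, (i < k)%N -> (j < l)%N ->
    (maxn i j + 1 < minn k l)%N -> z i j * z k l = z k l * z i j;
  A20_diag1 : forall i j k l : 'I_3, (i < k)%N -> (j < l)%N ->
    (maxn i j + 1)%N = minn k l ->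
    z i j * z k l - z k l * z i j = z i l * z k j;
  A20_det : z i1 i1 * z i2 i2 * z i3 i3 = 1;
  A20_star11 : star (z i1 i1) = z i2 i2 * z i3 i3;
  A20_star22 : star (z i2 i2) = z i1 i1 * z i3 i3;
  A20_star33 : star (z i3 i3) = z i1 i1 * z i2 i2;
  A20_star21 : star (z i2 i1) = z i1 i2 * z i3 i3;
  A20_star32 : star (z i3 i2) = z i1 i1 * z i2 i3;
  A20_star31 : star (z i3 i1) = z i1 i2 * z i2 i3;
  A20_star12 : star (z i1 i2) = z i2 i1 * z i3 i3;
  A20_star23 : star (z i2 i3) = z i1 i1 * z i3 i2;
  A20_star13 : star (z i1 i3) = z i2 i1 * z i3 i2;
  A20_star_comm : forall i j r s : 'I_3, i != r -> j != s ->
    star (z i j) * z r s = z r s * star (z i j)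
}.

(* (A, z) is the universal unital C*-algebra generated by the z i j subject to
   the relations above; it is unique up to a unique isomorphism. *)
Definition is_A20 (A : cstarAlgType R) (z : 'I_3 -> 'I_3 -> A) : Prop :=
  A20_relations z /\
  forall (B : cstarAlgType R) (w : 'I_3 -> 'I_3 -> B), A20_relations w ->
    exists! f : A -> B, star_hom f /\ forall i j, f (z i j) = w i j.

End A20.

(* Main.v *)
From HB Require Import structures.
Require Import Defs.
From mathcomp Require Import all_boot all_order all_algebra complex.
From mathcomp Require Import boolp classical_sets reals.
From mathcomp Require Import zify ring lra.

Set Implicit Arguments.
Unset Strict Implicit.
Unset Printing Implicit Defensive.

Import Order.TTheory GRing.Theory Num.Theory.
Import ComplexField.Normc.

Local Open Scope ring_scope.
Local Open Scope complex_scope.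

(** Write w i j for the sum over k between i and j of z i k (x) z k j.

    Everything rests on the fact that the w i j satisfy the relations of the
    z i j ([delta_relations]): the universal property of A then yields Delta,
    and it yields the counit because the identity matrix satisfies the same
    relations ([counit_relations]). That fact is a computation with words in
    the z i j. The row, column, crossing and diagonal relations are read as
    rewriting rules, which sort a word by decreasing (max, min) of the indices
    of its letters and have coefficients 0 and 1 only; to these is added that
    (z 3 1)^* = z 1 2 z 2 3 and (z 1 3)^* = z 2 1 z 3 2 commute with the
    letters outside row 3 and column 1, respectively outside row 1 and
    column 3. Every adjoint is itself a word of
    length two, so both sides of each relation between the w i j, except
    w 1 1 w 2 2 w 3 3 = 1, are sums of tensors of two words. Rewriting both
    legs turns the two sides into the same multiset of tensors. The remaining
    relation is immediate, since w i i = z i i (x) z i i.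

    The bialgebra axioms are then identities between *-homomorphisms out of A,
    and it suffices to check them on the z i j ([is_A20_ext]), where
    coassociativity says that k between i and j and l between i and k amount
    to l between i and j and k between l and j.

    What is left is to construct the *-homomorphisms out of tensor products:
    Delta (x) id, id (x) Delta, the associator, and the maps that absorb the
    counit. Two *-homomorphisms with commuting ranges define a contraction on
    the algebraic tensor product, by the maximality of the norm, and this
    contraction extends by density and completeness ([tensor_lift]). That the
    associator is bijective requires in addition that *-homomorphisms out of a
    tensor product be determined by their values on elementary tensors
    ([tensor_ext]), hence that *-homomorphisms be continuous
    ([star_hom_bounded]). *)

(** * Algebra of *-homomorphisms *)

Section StarHom.
Variable R : realType.
Implicit Types A B C : starAlgType R.

Lemma star0 A : star (0 : A) = 0.
Proof. by have := starZ 0 (0 : A); rewrite rmorph0 !scale0r. Qed.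

Lemma star1 A : star (1 : A) = 1.
Proof. by rewrite -[LHS]mulr1 -{2}[1]starK -starM mulr1 starK. Qed.

Lemma starN A (x : A) : star (- x) = - star x.
Proof. by apply/eqP; rewrite -subr_eq0 opprK -starD addNr star0. Qed.

Lemma star_homD A B (f : A -> B) : star_hom f -> {morph f : x y / x + y}.
Proof. by case=> fl _ _ x y; have := fl 1 x y; rewrite !scale1r. Qed.

Lemma star_hom0 A B (f : A -> B) : star_hom f -> f 0 = 0.
Proof. by move=> /star_homD fD; apply: (addrI (f 0)); rewrite -fD !addr0. Qed.

Lemma star_homZ A B (f : A -> B) c x : star_hom f -> f (c *: x) = c *: f x.
Proof.
by move=> fP; case: (fP) => /(_ c x 0); rewrite !addr0 (star_hom0 fP) addr0.
Qed.

Lemma star_homB A B (f : A -> B) x y : star_hom f -> f (x - y) = f x - f y.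
Proof. by move=> fP; rewrite star_homD // -scaleN1r star_homZ // scaleN1r. Qed.

Lemma star_homM A B (f : A -> B) : star_hom f -> {morph f : x y / x * y}.
Proof. by case=> _ []. Qed.

Lemma star_hom1 A B (f : A -> B) : star_hom f -> f 1 = 1.
Proof. by case=> _ []. Qed.

Lemma star_homS A B (f : A -> B) : star_hom f -> {morph f : x / star x}.
Proof. by case. Qed.

Lemma star_hom_sum A B (f : A -> B) I (s : seq I) (P : pred I) (F : I -> A) :
  star_hom f -> f (\sum_(i <- s | P i) F i) = \sum_(i <- s | P i) f (F i).
Proof. by move=> fP; apply: (big_morph f (star_homD fP) (star_hom0 fP)). Qed.

Lemma star_hom_id A : star_hom (@id A).
Proof. by []. Qed.

Lemma star_hom_comp A B C (f : A -> B) (g : B -> C) :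
  star_hom f -> star_hom g -> star_hom (g \o f).
Proof.
move=> fP gP; split; [move=> c x y | split=> [|x y] | move=> x] => /=.
- by rewrite star_homD // star_homZ // star_homD // star_homZ.
- by rewrite !star_hom1.
- by rewrite !star_homM.
- by rewrite !star_homS.
Qed.

End StarHom.

Section AlgTensor.
Variables (R : realType) (A B T : starAlgType R) (t : A -> B -> T).
Hypothesis tP : alg_tensor t.

Lemma tensor_suml I (s : seq I) (P : pred I) (F : I -> A) b :
  t (\sum_(i <- s | P i) F i) b = \sum_(i <- s | P i) t (F i) b.
Proof.
case: tP => -[tl _] _ _ _ _.
have tD : {morph t^~ b : x y / x + y}.
  by move=> x y; have := tl b 1 x y; rewrite !scale1r.
by apply: (big_morph _ tD); apply: (addrI (t 0 b)); rewrite -tD !addr0.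
Qed.

Lemma tensor_sumr I (s : seq I) (P : pred I) (F : I -> B) a :
  t a (\sum_(i <- s | P i) F i) = \sum_(i <- s | P i) t a (F i).
Proof.
case: tP => -[_ tr] _ _ _ _.
have tD : {morph t a : x y / x + y}.
  by move=> x y; have := tr a 1 x y; rewrite !scale1r.
by apply: (big_morph _ tD); apply: (addrI (t a 0)); rewrite -tD !addr0.
Qed.

End AlgTensor.

(** * Norm and limits in a C*-algebra *)

Section Norm.
Variables (R : realType) (A : cstarAlgType R).
Implicit Types (x y l : A) (u v : nat -> A).

Lemma cnorm0 : cnorm (0 : A) = 0.
Proof. by rewrite -(scale0r (0 : A)) cnormZ normc0 mul0r. Qed.

Lemma cnorm_gt0 x : x != 0 -> 0 < cnorm x.
Proof.
move=> x0; rewrite lt_neqAle cnorm_ge0 andbT eq_sym.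
by apply: contra x0 => /eqP/cnorm_eq0->.
Qed.

Lemma cnormN x : cnorm (- x) = cnorm x.
Proof. by rewrite -scaleN1r cnormZ normcN normc1 mul1r. Qed.

Lemma cnormB x y : cnorm (x - y) <= cnorm x + cnorm y.
Proof. by rewrite -(cnormN y) cnormD. Qed.

Lemma cnorm_dist x y : cnorm (x - y) = cnorm (y - x).
Proof. by rewrite -cnormN opprB. Qed.

Lemma cnorm1 : cnorm (1 : A) = 1.
Proof.
have n1 : cnorm (1 : A) != 0.
  by apply/eqP => /cnorm_eq0 /eqP; rewrite oner_eq0.
apply: (mulfI n1).
by have := cnorm_cstar (1 : A); rewrite star1 !mulr1 expr2 => <-.
Qed.

Lemma cnorm_le_star x : cnorm x <= cnorm (star x).
Proof.
have [->|x0] := eqVneq x 0; first by rewrite star0.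
by rewrite -(ler_pM2r (cnorm_gt0 x0)) -expr2 -cnorm_cstar cnormM.
Qed.

Lemma cnorm_star x : cnorm (star x) = cnorm x.
Proof.
by apply/eqP; rewrite eq_le cnorm_le_star andbT -{2}[x]starK cnorm_le_star.
Qed.

Lemma cnorm_real (r : R) x : 0 <= r -> cnorm (r%:C *: x) = r * cnorm x.
Proof.
by move=> r0; rewrite cnormZ /= expr0n addr0 sqrtr_sqr ger0_norm.
Qed.

Definition cvg_to u l : Prop :=
  forall e : R, 0 < e -> exists N, forall n, (N <= n)%N -> cnorm (u n - l) < e.

Lemma cvg_to_unique u l l' : cvg_to u l -> cvg_to u l' -> l = l'.
Proof.
move=> ul ul'; apply/eqP; rewrite -subr_eq0; apply/eqP/cnorm_eq0/eqP.
rewrite eq_le cnorm_ge0 andbT leNgt; apply/negP => lt.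
have e0 : 0 < cnorm (l - l') / 2 by rewrite divr_gt0.
have [N uN] := ul _ e0; have [N' uN'] := ul' _ e0.
have := cnormB (u (maxn N N') - l') (u (maxn N N') - l).
have -> : u (maxn N N') - l' - (u (maxn N N') - l) = l - l'.
  by rewrite opprB addrC addrA subrK.
by have := uN _ (leq_maxl N N'); have := uN' _ (leq_maxr N N'); lra.
Qed.

Lemma cvg_to_cst l : cvg_to (fun=> l) l.
Proof. by move=> e e0; exists 0%N => n _; rewrite subrr cnorm0. Qed.

Lemma cvg_to_ext u v l : u =1 v -> cvg_to u l -> cvg_to v l.
Proof. by move=> uv ul e /ul[N uN]; exists N => n /uN; rewrite uv. Qed.

Lemma cvg_to_shift u l : cvg_to u l -> cvg_to (fun n => u n.+1) l.
Proof. by move=> ul e /ul[N uN]; exists N => n le; apply/uN/leqW. Qed.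

End Norm.

Section Limits.
Variable R : realType.

(** The limit rules for sums, products, scalings and adjoints are all instances
    of this comparison, which is why it relates sequences of three algebras. *)
Lemma cvg_to_dominated (A B C : cstarAlgType R) (K : R) N
    (u : nat -> A) l (v : nat -> B) m (w : nat -> C) k : 0 < K ->
  (forall n, (N <= n)%N ->
    cnorm (w n - k) <= K * (cnorm (u n - l) + cnorm (v n - m))) ->
  cvg_to u l -> cvg_to v m -> cvg_to w k.
Proof.
move=> K0 wle ul vm e e0.
have d0 : 0 < e / K / 2 by rewrite !divr_gt0.
have [[N1 uN] [N2 vN]] := (ul _ d0, vm _ d0).
exists (maxn N (maxn N1 N2)) => n; rewrite !geq_max => /and3P[le le1 le2].
apply: le_lt_trans (wle n le) _; rewrite mulrC -ltr_pdivlMr //.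
by have := uN n le1; have := vN n le2; lra.
Qed.

Lemma cvg_to_lipschitz (A B : cstarAlgType R) (K : R) (f : A -> B) u l :
  (forall x y, cnorm (f x - f y) <= K * cnorm (x - y)) ->
  cvg_to u l -> cvg_to (fun n => f (u n)) (f l).
Proof.
move=> fK ul.
apply: (@cvg_to_dominated _ _ _ (`|K| + 1) 0 _ _ _ _ _ _ _ _ ul ul).
  by rewrite ltr_wpDl.
move=> n _; apply: le_trans (fK _ _) _.
by have := cnorm_ge0 (u n - l); have := ler_norm K; have := normr_ge0 K; nra.
Qed.

Lemma cvg_toD (A : cstarAlgType R) (u v : nat -> A) l m :
  cvg_to u l -> cvg_to v m -> cvg_to (fun n => u n + v n) (l + m).
Proof.
apply: (@cvg_to_dominated _ _ _ 1 0) => // n _.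
by rewrite mul1r opprD addrACA cnormD.
Qed.

Lemma cvg_toZ (A : cstarAlgType R) c (u : nat -> A) l :
  cvg_to u l -> cvg_to (fun n => c *: u n) (c *: l).
Proof.
by apply: (@cvg_to_lipschitz _ _ (normc c)) => x y; rewrite -scalerBr cnormZ.
Qed.

Lemma cvg_to_star (A : cstarAlgType R) (u : nat -> A) l :
  cvg_to u l -> cvg_to (fun n => star (u n)) (star l).
Proof.
apply: (@cvg_to_lipschitz _ _ 1) => x y.
by rewrite mul1r -starN -starD cnorm_star.
Qed.

Lemma cvg_toM (A : cstarAlgType R) (u v : nat -> A) l m :
  cvg_to u l -> cvg_to v m -> cvg_to (fun n => u n * v n) (l * m).
Proof.
move=> ul vm; have [N vN] := vm 1 ltr01.
(* From the rank N on, the norm of v n is at most cnorm m + 1. *)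
apply: (@cvg_to_dominated _ _ _ (cnorm l + cnorm m + 1) N _ _ _ _ _ _ _ _ ul vm).
  by have := cnorm_ge0 l; have := cnorm_ge0 m; lra.
move=> n le; have -> : u n * v n - l * m = (u n - l) * v n + l * (v n - m).
  by rewrite mulrBl mulrBr addrA subrK.
have := cnormD ((u n - l) * v n) (l * (v n - m)).
have := cnormM (u n - l) (v n); have := cnormM l (v n - m).
have := cnormD (v n - m) m; rewrite subrK; have := vN n le.
have := cnorm_ge0 l; have := cnorm_ge0 m; have := cnorm_ge0 (u n - l).
have := cnorm_ge0 (v n - m); have := cnorm_ge0 (v n).
by nra.
Qed.

Lemma halfX_small (e : R) : 0 < e ->
  exists N, forall n, (N <= n)%N -> 2^-1 ^+ n < e.
Proof.
move=> e0; exists (Num.bound e^-1) => n le.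
rewrite exprVn invf_plt ?posrE ?exprn_gt0 //.
exact: upper_nthrootP.
Qed.

Lemma cvg_to_halfX (A : cstarAlgType R) (u : nat -> A) l :
  (forall n, cnorm (u n - l) <= 2^-1 ^+ n) -> cvg_to u l.
Proof.
move=> ule e /halfX_small[N ltN]; exists N => n /ltN.
exact: le_lt_trans (ule n).
Qed.

Lemma dense_cvg_to (A : cstarAlgType R) (Q : A -> Prop) x :
  (forall e : R, 0 < e -> exists y, Q y /\ cnorm (x - y) < e) ->
  exists u : nat -> A, (forall n, Q (u n)) /\ cvg_to u x.
Proof.
move=> dense.
have /choice[u uP] n : exists y, Q y /\ cnorm (x - y) < 2^-1 ^+ n.
  by apply: dense; rewrite exprn_gt0 // invr_gt0.
exists u; split=> [n|]; first by case: (uP n).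
by apply: cvg_to_halfX => n; rewrite cnorm_dist ltW //; case: (uP n).
Qed.

End Limits.

(** * Continuity of *-homomorphisms *)

Section Continuity.
Variable R : realType.
Implicit Types A B : cstarAlgType R.

(** If b = 1 - l, then b * b = 1 - x says that l is a fixed point of
    y |-> (x + y * y) / 2, a map of the ball of radius 1/2 into itself which
    is a contraction there. The iterates from 0 are polynomials in x, which
    is why l is self-adjoint and commutes with whatever commutes with x. *)
Lemma sqrt_one_minus A (x : A) : star x = x -> cnorm x <= 2^-1 ->
  exists b : A, [/\ star b = b, b * b = 1 - x
    & forall c, c * x = x * c -> c * b = b * c].
Proof.
move=> sx nx; pose h : R[i] := (2^-1 : R)%:C.
have hh : h + h = 1 by rewrite -rmorphD (_ : _ + _ = 1) //; lra.
pose S y := h *: (x + y * y); pose y n := iter n S 0.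
have nh (w : A) : cnorm (h *: w) = 2^-1 * cnorm w.
  by rewrite cnorm_real // invr_ge0.
have ny n : cnorm (y n) <= 2^-1.
  elim: n => [|n IHn] /=; first by rewrite cnorm0 invr_ge0.
  rewrite nh; have := cnormD x (y n * y n); have := cnormM (y n) (y n).
  by have := cnorm_ge0 (y n); nra.
have dist m n : cnorm (y (n + m)%N - y n) <= 2^-1 ^+ n.
  elim: n => [|n IHn] /=.
    by rewrite subr0 expr0; apply: le_trans (ny _) _; lra.
  rewrite -scalerBr nh opprD addrACA subrr add0r exprS.
  apply: ler_pM => //; rewrite ?invr_ge0 ?cnorm_ge0 //; apply: le_trans IHn.
  set p := y (n + m)%N; set q := y n.
  have -> : p * p - q * q = p * (p - q) + (p - q) * q.
    by rewrite mulrBr mulrBl addrA subrK.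
  have := cnormD (p * (p - q)) ((p - q) * q).
  have := cnormM p (p - q); have := cnormM (p - q) q.
  have := ny (n + m)%N; have := ny n; rewrite -/p -/q.
  by have := cnorm_ge0 (p - q); nra.
have [l yl] : exists l, cvg_to y l.
  apply: cnorm_complete => e e0.
  have [N /(_ N (leqnn N)) ltN] := halfX_small (divr_gt0 e0 (@ltr0n R 2)).
  exists N => m n leNm leNn.
  have -> : y m - y n = (y m - y N) - (y n - y N) by rewrite opprB addrA subrK.
  apply: le_lt_trans (cnormB _ _) _.
  by have := dist (m - N)%N N; have := dist (n - N)%N N; rewrite !subnKC //; lra.
have lE : l = h *: (x + l * l).
  apply: (cvg_to_unique (cvg_to_shift yl)).
  by apply/cvg_toZ/cvg_toD/cvg_toM => //; apply: cvg_to_cst.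
exists (1 - l); split.
- have sl : star l = l.
    apply: (cvg_to_unique _ yl); apply: cvg_to_ext (cvg_to_star yl) => n.
    elim: n => [|n IHn]; first exact: star0.
    by rewrite /= starZ starD sx starM IHn conjc_real.
  by rewrite starD starN star1 sl.
- have l2 : l + l = x + l * l by rewrite -[x + _]scale1r -hh scalerDl -lE.
  have -> : (1 - l) * (1 - l) = 1 - (l + l) + l * l.
    by rewrite mulrBr mulr1 mulrBl mul1r opprB opprD !addrA addrAC.
  by rewrite l2 opprD addrA subrK.
- move=> c cx; rewrite mulrBr mulrBl mulr1 mul1r; congr (_ - _).
  have cyl := cvg_toM (cvg_to_cst c) yl; apply: (cvg_to_unique cyl).
  have ylc := cvg_toM yl (cvg_to_cst c); apply: cvg_to_ext ylc.
  elim=> [|n IHn] /=; first by rewrite mul0r mulr0.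
  rewrite -scalerAl -scalerAr; congr (_ *: _).
  by rewrite mulrDl mulrDr cx -[_ * _ * c]mulrA IHn !mulrA IHn.
Qed.

(** With b a square root of 1 - a * a that commutes with a, the element a + ib
    is unitary, and so is its image; f a is the real part of the latter. *)
Lemma star_hom_bounded_selfadjoint A B (f : A -> B) a : star_hom f ->
  star a = a -> cnorm a <= 2^-1 -> cnorm (f a) <= 1.
Proof.
move=> fP sa na.
have saa : star (a * a) = a * a by rewrite starM sa.
have naa : cnorm (a * a) <= 2^-1.
  by have := cnormM a a; have := cnorm_ge0 a; nra.
have [b [sb bb cb]] := sqrt_one_minus saa naa.
have ab : a * b = b * a by apply: cb; rewrite mulrA.
pose i : R[i] := 0 +i* 1; pose u := f a + i *: f b.
have ii : i * i = -1.
  by apply/eqP; rewrite eq_complex /=; apply/andP; split; apply/eqP; ring.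
have ic : conjc i = - i by apply/eqP; rewrite eq_complex /= oppr0 !eqxx.
have su : star u = f a - i *: f b.
  by rewrite starD starZ -!star_homS // sa sb ic scaleNr.
have uu : star u * u = 1.
  rewrite su mulrBl !mulrDr -!scalerAl -!scalerAr scalerA ii scaleN1r.
  rewrite -!(star_homM fP) // ab opprD opprK addrA addrK -(star_homD fP) bb.
  by rewrite addrC subrK (star_hom1 fP).
have nu : cnorm u = 1.
  apply/eqP; rewrite -(@eqrXn2 _ 2) ?cnorm_ge0 //.
  by rewrite -cnorm_cstar uu cnorm1 expr1n.
have aE : (2 : R)%:C *: f a = u + star u.
  by rewrite su /u addrACA subrr addr0 rmorphD /= scalerDl scale1r.
have := cnormD u (star u); rewrite -aE cnorm_real // cnorm_star nu; lra.
Qed.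

(** The self-adjoint case follows by scaling, and the general case from it and
    the C*-identity. The optimal constant is 1, but any constant gives
    continuity, which is what this is for. *)
Lemma star_hom_bounded A B (f : A -> B) x : star_hom f ->
  cnorm (f x) <= 2 * cnorm x.
Proof.
move=> fP.
have sa_bound a : star a = a -> cnorm (f a) <= 2 * cnorm a.
  move=> sa; have [->|a0] := eqVneq a 0.
    by rewrite star_hom0 // !cnorm0 mulr0.
  have n0 := cnorm_gt0 a0; pose r := (2 * cnorm a)^-1.
  have r0 : 0 < r by rewrite invr_gt0 mulr_gt0.
  have := @star_hom_bounded_selfadjoint _ _ f (r%:C *: a) fP.
  rewrite starZ conjc_real sa star_homZ // !cnorm_real ?(ltW r0) //.
  move=> /(_ erefl); rewrite {1}/r invfM mulfVK ?gt_eqF // lexx => /(_ isT).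
  by rewrite /r mulrC ler_pdivrMr ?mulr_gt0 // mul1r.
have := sa_bound (star x * x); rewrite starM starK => /(_ erefl).
rewrite star_homM // star_homS // !cnorm_cstar.
by have := cnorm_ge0 x; have := cnorm_ge0 (f x); nra.
Qed.

Lemma star_hom_cvg A B (f : A -> B) u l : star_hom f ->
  cvg_to u l -> cvg_to (fun n => f (u n)) (f l).
Proof.
move=> fP; apply: (@cvg_to_lipschitz _ _ _ 2) => x y.
by rewrite -star_homB // star_hom_bounded.
Qed.

End Continuity.

(** * Extension of a densely defined contraction *)

Section Extension.
Variables (R : realType) (T C : cstarAlgType R) (P : T -> C -> Prop).

(** P is the graph of a densely defined contractive *-homomorphism. It is given
    as a relation because a sum of elementary tensors has many expressions, and
    it is the bound on the norms which makes the value independent of them. *)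
Hypotheses
  (P1 : P 1 1)
  (PL : forall c x y x' y', P x y -> P x' y' -> P (c *: x + x') (c *: y + y'))
  (PM : forall x y x' y', P x y -> P x' y' -> P (x * x') (y * y'))
  (PS : forall x y, P x y -> P (star x) (star y))
  (Pnorm : forall x y, P x y -> cnorm y <= cnorm x)
  (Pdense : forall x (e : R), 0 < e ->
     exists x', (exists y, P x' y) /\ cnorm (x - x') < e).

Let Plim (x : T) (y : C) : Prop :=
  exists u v, [/\ forall n, P (u n) (v n), cvg_to u x & cvg_to v y].

Let Pdist x y x' y' : P x y -> P x' y' -> cnorm (y - y') <= cnorm (x - x').
Proof.
move=> Pxy Pxy'; rewrite cnorm_dist [leRHS]cnorm_dist; apply: Pnorm.
by rewrite addrC -scaleN1r [y' - y]addrC -[- y]scaleN1r; apply: PL.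
Qed.

Let Plim_exists x : exists y, Plim x y.
Proof.
have [u [/choice[v uv] ux]] := dense_cvg_to (Pdense x).
have [y vy] : exists y, cvg_to v y.
  apply: cnorm_complete => e e0.
  have [N uN] := ux _ (divr_gt0 e0 (@ltr0n R 2)); exists N => m n /uN um /uN un.
  apply: le_lt_trans (Pdist (uv m) (uv n)) _.
  have -> : u m - u n = (u m - x) - (u n - x) by rewrite opprB addrA subrK.
  by apply: le_lt_trans (cnormB _ _) _; lra.
by exists y, u, v.
Qed.

Let Plim_unique x y y' : Plim x y -> Plim x y' -> y = y'.
Proof.
move=> [u [v [uv ux vy]]] [u' [v' [uv' ux' vy']]].
suff vy2 : cvg_to v' y by apply: cvg_to_unique vy2 vy'.
pose w n := u' n - u n.
have w0 : cvg_to w 0.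
  have := cvg_toD ux' (cvg_toZ (-1) ux); rewrite scaleN1r subrr.
  by apply: cvg_to_ext => n; rewrite scaleN1r.
apply: (@cvg_to_dominated _ _ _ _ 1 0 _ _ _ _ _ _ _ _ w0 vy) => // n _.
have -> : v' n - y = (v' n - v n) + (v n - y) by rewrite addrA subrK.
by rewrite mul1r subr0 (le_trans (cnormD _ _)) // lerD2r Pdist.
Qed.

Lemma star_hom_extend :
  exists h : T -> C, star_hom h /\ forall x y, P x y -> h x = y.
Proof.
have /choice[h hP] := Plim_exists; have hE x y : Plim x y -> h x = y.
  exact: Plim_unique.
have PlimP x y : P x y -> Plim x y.
  by move=> Pxy; exists (fun=> x), (fun=> y); split=> //; apply: cvg_to_cst.
exists h; split=> [|x y /PlimP/hE //]; split=> [c x x'| |x].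
- have [[u [v [uv ux vy]]] [u' [v' [uv' ux' vy']]]] := (hP x, hP x').
  apply: hE; exists (fun n => c *: u n + u' n), (fun n => c *: v n + v' n).
  split=> [n||]; first exact: PL.
    by apply/cvg_toD/ux'/cvg_toZ.
  by apply/cvg_toD/vy'/cvg_toZ.
- split=> [|x x']; first exact/hE/PlimP.
  have [[u [v [uv ux vy]]] [u' [v' [uv' ux' vy']]]] := (hP x, hP x').
  apply: hE; exists (fun n => u n * u' n), (fun n => v n * v' n).
  by split=> [n||]; [apply: PM | apply: cvg_toM | apply: cvg_toM].
- have [u [v [uv ux vy]]] := hP x.
  apply: hE; exists (fun n => star (u n)), (fun n => star (v n)).
  by split=> [n||]; [apply: PS | apply: cvg_to_star | apply: cvg_to_star].
Qed.

End Extension.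

(** * Homomorphisms out of tensor products *)

Section TensorProduct.
Variables (R : realType) (A B : cstarAlgType R) (T : cstarTensor A B).
Local Notation t := (tensor T).

Lemma tensor_alg_tensor : alg_tensor t.
Proof. by case: (tensorP T). Qed.

Lemma tensor11 : t 1 1 = 1.
Proof. by case: tensor_alg_tensor. Qed.

Lemma tensorM a a' b b' : t a b * t a' b' = t (a * a') (b * b').
Proof. by case: tensor_alg_tensor. Qed.

Lemma tensor_hom_l : star_hom (t^~ 1).
Proof.
case: tensor_alg_tensor => -[tl _] t1 tM tS _.
split=> //; last by move=> x; rewrite tS star1.
by split=> // x y; rewrite tM mulr1.
Qed.

Lemma tensor_hom_r : star_hom (t 1).
Proof.
case: tensor_alg_tensor => -[_ tr] t1 tM tS _.
split=> //; last by move=> x; rewrite tS star1.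
by split=> // x y; rewrite tM mulr1.
Qed.

Lemma tensor_split a b : t a b = t a 1 * t 1 b.
Proof. by rewrite tensorM mulr1 mul1r. Qed.

Lemma tensor_commute a b : t a 1 * t 1 b = t 1 b * t a 1.
Proof. by rewrite !tensorM !mulr1 !mul1r. Qed.

Lemma tensor_dense (x : T) (e : R) : 0 < e ->
  exists s : seq (A * B), cnorm (x - \sum_(p <- s) t p.1 p.2) < e.
Proof.
case: (tensorP T) => _ dense _ e0; have [n [a [b lt]]] := dense x e e0.
by exists [seq (a i, b i) | i : 'I_n]; rewrite big_image.
Qed.

Lemma tensor_ext (C : cstarAlgType R) (f g : T -> C) :
  star_hom f -> star_hom g -> (forall a b, f (t a b) = g (t a b)) -> f =1 g.
Proof.
move=> fP gP fg x.
have dense e : 0 < e -> exists y, f y = g y /\ cnorm (x - y) < e.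
  move=> /(tensor_dense x)[s lt]; exists (\sum_(p <- s) t p.1 p.2); split=> //.
  by rewrite !star_hom_sum //; apply: eq_bigr.
have [u [fgu ux]] := dense_cvg_to dense.
apply: (cvg_to_unique (star_hom_cvg fP ux)).
by apply: cvg_to_ext (star_hom_cvg gP ux) => n; rewrite fgu.
Qed.

Lemma tensor_commute_ext (C : cstarAlgType R) (f : T -> C) y :
  star_hom f -> (forall a b, f (t a b) * y = y * f (t a b)) ->
  forall x, f x * y = y * f x.
Proof.
move=> fP comm x.
have dense e : 0 < e -> exists x', f x' * y = y * f x' /\ cnorm (x - x') < e.
  move=> /(tensor_dense x)[s lt]; exists (\sum_(p <- s) t p.1 p.2); split=> //.
  by rewrite star_hom_sum // mulr_suml mulr_sumr; apply: eq_bigr.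
have [u [fu ux]] := dense_cvg_to dense.
apply: (cvg_to_unique (cvg_toM (star_hom_cvg fP ux) (cvg_to_cst y))).
have yu := cvg_toM (cvg_to_cst y) (star_hom_cvg fP ux).
by apply: cvg_to_ext yu => n; rewrite fu.
Qed.

(** The universal property of the greatest C*-norm. *)
Lemma tensor_lift (C : cstarAlgType R) (f : A -> C) (g : B -> C) :
  star_hom f -> star_hom g -> (forall a b, f a * g b = g b * f a) ->
  exists h : T -> C, star_hom h /\ forall a b, h (t a b) = f a * g b.
Proof.
move=> fP gP fg; have [_ t1 tM tS _] := tensor_alg_tensor.
pose P (x : T) (y : C) := exists s : seq (A * B),
  x = \sum_(p <- s) t p.1 p.2 /\ y = \sum_(p <- s) f p.1 * g p.2.
suff [h [hP hE]] :
    exists h : T -> C, star_hom h /\ forall x y, P x y -> h x = y.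
  by exists h; split=> // a b; apply: hE; exists [:: (a, b)]; rewrite !big_seq1.
have tlZ c a b : t (c *: a) b = c *: t a b.
  by rewrite tensor_split (star_homZ _ _ tensor_hom_l) -scalerAl -tensor_split.
apply: star_hom_extend.
- by exists [:: (1, 1)]; rewrite !big_seq1 t1 (star_hom1 fP) (star_hom1 gP) mulr1.
- move=> c x y x' y' [s [-> ->]] [s' [-> ->]].
  exists ([seq (c *: p.1, p.2) | p <- s] ++ s'); rewrite !big_cat !big_map /=.
  rewrite !scaler_sumr; split; congr (_ + _); apply: eq_bigr => p _.
    by rewrite tlZ.
  by rewrite (star_homZ _ _ fP) scalerAl.
- move=> x y x' y' [s [-> ->]] [s' [-> ->]].
  exists [seq (p.1 * q.1, p.2 * q.2) | p <- s, q <- s'].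
  rewrite !big_allpairs_dep !mulr_suml; split; apply: eq_bigr => p _;
    rewrite mulr_sumr; apply: eq_bigr => q _ /=; first by rewrite tM.
  rewrite (star_homM fP) (star_homM gP) -!mulrA [g _ * (_ * _)]mulrA -fg.
  by rewrite !mulrA.
- move=> x y [s [-> ->]]; exists [seq (star p.1, star p.2) | p <- s].
  rewrite !big_map !(big_morph _ (@starD _ _) (star0 _)).
  split; apply: eq_bigr => p _ /=; first exact: tS.
  by rewrite starM fg (star_homS fP) (star_homS gP).
- move=> x y [s [-> ->]]; case: (tensorP T) => _ _ /(_ C f g fP gP fg) norm.
  by rewrite !(big_nth (1, 1)) !big_mkord; apply: norm.
- move=> x e /(tensor_dense x)[s lt]; exists (\sum_(p <- s) t p.1 p.2).
  by split=> //; exists (\sum_(p <- s) f p.1 * g p.2), s.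
Qed.

End TensorProduct.

Lemma tensor_hom_exists (R : realType) (A B A' B' : cstarAlgType R)
    (T : cstarTensor A B) (T' : cstarTensor A' B') (f : A -> A') (g : B -> B') :
  star_hom f -> star_hom g -> exists h : T -> T', tensor_hom f g h.
Proof.
move=> fP gP.
have [|h [hP hE]] := tensor_lift T (star_hom_comp fP (tensor_hom_l T'))
  (star_hom_comp gP (tensor_hom_r T')).
  by move=> a b; apply: tensor_commute.
by exists h; split=> // a b; rewrite hE -tensor_split.
Qed.

Section Associator.
Variables (R : realType) (A B C : cstarAlgType R).
Variables (T1 : cstarTensor A B) (T2 : cstarTensor B C).
Variables (TL : cstarTensor T1 C) (TR : cstarTensor A T2).

Lemma assoc_right : exists h : TL -> TR, star_hom h /\
  forall a b c, h (tensor TL (tensor T1 a b) c) = tensor TR a (tensor T2 b c).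
Proof.
have gP := star_hom_comp (tensor_hom_l T2) (tensor_hom_r TR).
have [|f [fP fE]] := tensor_lift T1 (tensor_hom_l TR) gP.
  by move=> a b; apply: tensor_commute.
have [|h [hP hE]] :=
  tensor_lift TL fP (star_hom_comp (tensor_hom_r T2) (tensor_hom_r TR)).
  move=> x c /=; apply: (tensor_commute_ext fP) => {x} a b.
  by rewrite fE /= !tensorM !(mulr1, mul1r) !tensorM !(mulr1, mul1r).
exists h; split=> // a b c; rewrite hE fE /=.
by rewrite !tensorM !(mulr1, mul1r) tensorM mulr1 mul1r.
Qed.

Lemma assoc_left : exists h : TR -> TL, star_hom h /\
  forall a b c, h (tensor TR a (tensor T2 b c)) = tensor TL (tensor T1 a b) c.
Proof.
have fP := star_hom_comp (tensor_hom_r T1) (tensor_hom_l TL).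
have [|g [gP gE]] := tensor_lift T2 fP (tensor_hom_r TL).
  by move=> b c; apply: tensor_commute.
have [|h [hP hE]] :=
  tensor_lift TR (star_hom_comp (tensor_hom_l T1) (tensor_hom_l TL)) gP.
  move=> a x /=; apply/esym; apply: (tensor_commute_ext gP) => {x} b c.
  by rewrite gE /= !tensorM !(mulr1, mul1r) !tensorM !(mulr1, mul1r).
exists h; split=> // a b c; rewrite hE gE /=.
by rewrite !tensorM !(mulr1, mul1r) tensorM mulr1 mul1r.
Qed.

Lemma tensor3_extL (D : cstarAlgType R) (f g : TL -> D) :
  star_hom f -> star_hom g ->
  (forall a b c, f (tensor TL (tensor T1 a b) c)
               = g (tensor TL (tensor T1 a b) c)) -> f =1 g.
Proof.
move=> fP gP fg; apply: tensor_ext => // x c.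
rewrite tensor_split (star_homM fP) (star_homM gP); congr (_ * _); last first.
  by rewrite -(tensor11 T1) fg.
apply: (tensor_ext (star_hom_comp (tensor_hom_l TL) fP)
                   (star_hom_comp (tensor_hom_l TL) gP)) => a b.
exact: fg.
Qed.

Lemma tensor3_extR (D : cstarAlgType R) (f g : TR -> D) :
  star_hom f -> star_hom g ->
  (forall a b c, f (tensor TR a (tensor T2 b c))
               = g (tensor TR a (tensor T2 b c))) -> f =1 g.
Proof.
move=> fP gP fg; apply: tensor_ext => // a x.
rewrite tensor_split (star_homM fP) (star_homM gP); congr (_ * _).
  by rewrite -(tensor11 T2) fg.
apply: (tensor_ext (star_hom_comp (tensor_hom_r TR) fP)
                   (star_hom_comp (tensor_hom_r TR) gP)) => b c.
exact: fg.
Qed.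

Lemma assoc_bijective : exists h : TL -> TR,
  [/\ star_hom h, bijective h
    & forall a b c, h (tensor TL (tensor T1 a b) c)
                    = tensor TR a (tensor T2 b c)].
Proof.
have [[h [hP hE]] [k [kP kE]]] := (assoc_right, assoc_left).
exists h; split=> //; exists k => x.
  apply: (tensor3_extL (star_hom_comp hP kP) (star_hom_id _)) => a b c.
  by rewrite /= hE kE.
apply: (tensor3_extR (star_hom_comp kP hP) (star_hom_id _)) => a b c.
by rewrite /= kE hE.
Qed.

End Associator.

(** * The complex numbers as a C*-algebra *)

Section ComplexNumbers.
Variable R : realType.

(** The limit is the limit inferior, as the supremum of the eventual lower
    bounds. *)
Lemma real_complete (u : nat -> R) :
  (forall e : R, 0 < e -> exists N : nat, forall m n : nat,
     (N <= m)%N -> (N <= n)%N -> `|u m - u n| < e) ->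
  exists l, forall e : R, 0 < e -> exists N : nat, forall n : nat,
     (N <= n)%N -> `|u n - l| < e.
Proof.
move=> cauchy.
pose S : set R := fun x => exists N, forall n, (N <= n)%N -> x <= u n.
have S_near e N :
    (forall m n, (N <= m)%N -> (N <= n)%N -> `|u m - u n| < e) ->
    S (u N - e) /\ ubound S (u N + e).
  move=> uN; split=> [|x [M xM]].
    by exists N => n le; have := uN N n (leqnn N) le; rewrite ltr_norml; lra.
  have := uN N _ (leqnn N) (leq_maxl N M); have := xM _ (leq_maxr N M).
  by rewrite ltr_norml; lra.
exists (sup S) => e e0; have [N uN] := cauchy _ (divr_gt0 e0 (@ltr0n R 2)).
exists N => n le; have [lower upper] := S_near _ _ uN.
have le1 : u N - e / 2 <= sup S.
  by apply: ub_le_sup lower; exists (u N + e / 2).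
have le2 : sup S <= u N + e / 2.
  by apply: ge_sup upper; exists (u N - e / 2).
by have := uN n N le (leqnn N); rewrite !ltr_norml; lra.
Qed.

Lemma normc_Re (x : R[i]) : `|complex.Re x| <= normc x.
Proof. by case: x => a b /=; rewrite -sqrtr_sqr ler_wsqrtr // lerDl sqr_ge0. Qed.

Lemma normc_Im (x : R[i]) : `|complex.Im x| <= normc x.
Proof. by case: x => a b /=; rewrite -sqrtr_sqr ler_wsqrtr // lerDr sqr_ge0. Qed.

Lemma normc_le (x : R[i]) : normc x <= `|complex.Re x| + `|complex.Im x|.
Proof.
case: x => a b /=.
rewrite -(ler_pXn2r (_ : 0 < 2)%N) ?nnegrE ?sqrtr_ge0 ?addr_ge0 //.
rewrite sqr_sqrtr ?addr_ge0 ?sqr_ge0 // sqrrD !real_normK ?num_real //.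
by have := normr_ge0 a; have := normr_ge0 b; nra.
Qed.

Lemma complex_complete (u : nat -> R[i]) :
  (forall e : R, 0 < e -> exists N : nat, forall m n : nat,
     (N <= m)%N -> (N <= n)%N -> normc (u m - u n) < e) ->
  exists l, forall e : R, 0 < e -> exists N : nat, forall n : nat,
     (N <= n)%N -> normc (u n - l) < e.
Proof.
move=> cauchy.
have [a ua] : exists l, forall e : R, 0 < e -> exists N : nat, forall n : nat,
    (N <= n)%N -> `|complex.Re (u n) - l| < e.
  apply: real_complete => e /cauchy[N uN]; exists N => m n lem len.
  by rewrite -raddfB (le_lt_trans (normc_Re _)) // uN.
have [b ub] : exists l, forall e : R, 0 < e -> exists N : nat, forall n : nat,
    (N <= n)%N -> `|complex.Im (u n) - l| < e.
  apply: real_complete => e /cauchy[N uN]; exists N => m n lem len.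
  by rewrite -raddfB (le_lt_trans (normc_Im _)) // uN.
exists (a +i* b) => e e0; have e2 := divr_gt0 e0 (@ltr0n R 2).
have [[N uN] [M uM]] := (ua _ e2, ub _ e2).
exists (maxn N M) => n; rewrite geq_max => /andP[/uN lt1 /uM lt2].
by apply: le_lt_trans (normc_le _) _; rewrite !raddfB /=; lra.
Qed.

Lemma normc_ge0 (x : R[i]^o) : 0 <= normc x.
Proof. by case: x => a b; apply: sqrtr_ge0. Qed.

Lemma normc_submul (x y : R[i]^o) : normc (x * y) <= normc x * normc y.
Proof. by rewrite normcM. Qed.

Lemma normc_cstar (x : R[i]^o) : normc (star x * x) = normc x ^+ 2.
Proof.
by rewrite normcM expr2; congr (_ * _); case: x => a b; rewrite /= sqrrN.
Qed.

HB.instance Definition _ := StarAlgebra_isCstar.Build R R[i]^o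
  normc_ge0 (@eq0_normc R) (@le_normcD R) (fun c x => normcM c x)
  normc_submul normc_cstar complex_complete.

End ComplexNumbers.

(** * Normal forms of words in the generators *)

Definition gen := ('I_3 * 'I_3)%type.
Definition word := seq gen.

(** Orders the generators by the larger, then by the smaller index. *)
Definition level (x : gen) : nat := (3 * maxn x.1 x.2 + minn x.1 x.2)%N.

(** The right-hand side, as a sum of words, of the quadratic rule that applies
    to x * y. Crossing generators of the same level, such as z 1 2 and z 2 1,
    are sorted by row; a diagonal pair is swapped at the cost of the crossing
    pair in the same rows and columns. *)
Definition reorder (x y : gen) : option (seq word) :=
  let: (i, j) := x in let: (k, l) := y in
  if (i == k) && (j < l)%N || (j == l) && (i < k)%N then Some [::]
  else if (i < k)%N && (l < j)%N || (k < i)%N && (j < l)%N then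
    if (minn (maxn i k) (maxn j l) <= maxn (minn i k) (minn j l))%N
    then Some [::]
    else if (level x < level y)%N || (level x == level y) && (k < i)%N
    then Some [:: [:: y; x]] else None
  else if [&& (i < k)%N, (j < l)%N & (maxn i j < minn k l)%N] then
    Some ([:: y; x] ::
          if (maxn i j + 1 == minn k l)%N then [:: [:: (i, l); (k, j)]]
          else [::])
  else None.

Definition adjoint (x : gen) : word :=
  nth [::] [:: [:: (i2, i2); (i3, i3)]; [:: (i2, i1); (i3, i3)];
               [:: (i2, i1); (i3, i2)]; [:: (i1, i2); (i3, i3)];
               [:: (i1, i1); (i3, i3)]; [:: (i1, i1); (i3, i2)];
               [:: (i1, i2); (i2, i3)]; [:: (i1, i1); (i2, i3)];
               [:: (i1, i1); (i2, i2)]] (3 * x.1 + x.2).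

Definition commuting_adjoint (x : gen) (w : word) (y : gen) : bool :=
  [&& w == adjoint x, x.1 != y.1 & x.2 != y.2].

(** Of the relations on adjoints, only those of the corners (z 3 1)^* and
    (z 1 3)^* become rules: the normal forms given by these and by the
    quadratic rules already agree for all the relations to be checked. *)
Definition redex (w : word) : option (seq word) :=
  match w with
  | x :: y :: w' =>
    if reorder x y is Some p then Some [seq v ++ w' | v <- p] else
    if w' is v :: w'' then
      if commuting_adjoint (i3, i1) [:: x; y] v
         || commuting_adjoint (i1, i3) [:: x; y] v
      then Some [:: [:: v, x, y & w'']] else None
    else None
  | _ => None
  end.

Fixpoint rewrite_word (w : word) : option (seq word) :=
  if redex w is Some p then Some p else
  if w is x :: w' then omap (map (cons x)) (rewrite_word w') else None.

Fixpoint normalize (n : nat) (p : seq word) : seq word :=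
  if n is n'.+1 then
    normalize n' (flatten [seq odflt [:: w] (rewrite_word w) | w <- p])
  else p.

Section Monomials.
Variables (R : realType) (A : starAlgType R) (z : 'I_3 -> 'I_3 -> A).
Hypothesis zP : A20_relations z.

Definition monomial (w : word) : A := \prod_(x <- w) z x.1 x.2.

Lemma monomial_cons x w : monomial (x :: w) = z x.1 x.2 * monomial w.
Proof. exact: big_cons. Qed.

Lemma monomial_cat v w : monomial (v ++ w) = monomial v * monomial w.
Proof. exact: big_cat. Qed.

Lemma monomial1 x : monomial [:: x] = z x.1 x.2.
Proof. exact: big_seq1. Qed.

Lemma monomial2 x y : monomial [:: x; y] = z x.1 x.2 * z y.1 y.2.
Proof. by rewrite monomial_cons monomial1. Qed.

Definition all3 (P : 'I_3 -> bool) : bool := [&& P i1, P i2 & P i3].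

Lemma all3P (P : 'I_3 -> bool) : all3 P -> forall i, P i.
Proof.
move=> /and3P[P1 P2 P3] [[|[|[|//]]] lti].
- by rewrite (val_inj (erefl : val (Ordinal lti) = val i1)).
- by rewrite (val_inj (erefl : val (Ordinal lti) = val i2)).
- by rewrite (val_inj (erefl : val (Ordinal lti) = val i3)).
Qed.

Lemma star_gen x : star (z x.1 x.2) = monomial (adjoint x).
Proof.
case: x => i j; apply/eqP => /=; move: i j.
pose P i j := star (z i j) == monomial (adjoint (i, j)).
suff PP : all3 (fun i => all3 (P i)) by move=> i; apply: (all3P (all3P PP i)).
rewrite /P /adjoint /all3 /= !monomial2 /=.
rewrite (A20_star11 zP) (A20_star12 zP) (A20_star13 zP) (A20_star21 zP).
rewrite (A20_star22 zP) (A20_star23 zP) (A20_star31 zP) (A20_star32 zP).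
by rewrite (A20_star33 zP) !eqxx.
Qed.

Lemma crossing_comm (i j k l : 'I_3) :
  (i < k)%N && (l < j)%N || (k < i)%N && (j < l)%N ->
  z i j * z k l = z k l * z i j.
Proof.
case/orP=> /andP[]; last by move=> ki jl; rewrite (A20_cross zP ki jl).
by move=> ik lj; rewrite (A20_cross zP ik lj).
Qed.

Lemma reorderP x y p :
  reorder x y = Some p -> z x.1 x.2 * z y.1 y.2 = \sum_(w <- p) monomial w.
Proof.
case: x y => [i j] [k l]; rewrite /reorder.
case: ifPn => [/orP[]/andP[/eqP-> lt] [<-] | _].
- by rewrite big_nil (A20_row zP).
- by rewrite big_nil (A20_col zP).
case: ifPn => [cross | _].
  case: ifPn => [le [<-] | _].
    rewrite big_nil /=; move: cross le => /orP[]/andP[lt1 lt2].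
      rewrite (minn_idPl (ltnW lt1)) (maxn_idPr (ltnW lt1)).
      rewrite (minn_idPr (ltnW lt2)) (maxn_idPl (ltnW lt2)).
      exact: (A20_cross0 zP).
    rewrite (minn_idPr (ltnW lt1)) (maxn_idPl (ltnW lt1)).
    rewrite (minn_idPl (ltnW lt2)) (maxn_idPr (ltnW lt2)) => le.
    by rewrite -(A20_cross zP lt1 lt2) (A20_cross0 zP lt1 lt2).
  by case: ifP => // _ [<-]; rewrite big_seq1 monomial2 /= crossing_comm.
case: ifPn => // /and3P[ik jl lt] [<-]; rewrite big_cons monomial2 /=.
case: eqP => [eq1|neq1].
  by rewrite big_seq1 monomial2 /= -(A20_diag1 zP ik jl eq1) addrC subrK.
rewrite big_nil addr0 (A20_diag zP ik jl) // ltn_neqAle addn1 lt andbT.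
by apply/eqP; rewrite -addn1.
Qed.

Lemma commuting_adjointP x w y : commuting_adjoint x w y ->
  monomial w * z y.1 y.2 = z y.1 y.2 * monomial w.
Proof.
case/and3P=> /eqP-> x1 x2.
by rewrite -star_gen (A20_star_comm zP).
Qed.

Lemma redexP w p : redex w = Some p -> monomial w = \sum_(v <- p) monomial v.
Proof.
case: w => [|x [|y w]] //=.
case E: (reorder x y) => [q|].
  move=> [<-]; rewrite big_map (eq_bigr _ (fun v _ => monomial_cat v w)).
  by rewrite -mulr_suml -(reorderP E) !monomial_cons mulrA.
case: w => [|v w] //; case: ifP => // adj [<-]; rewrite big_seq1.
have comm : monomial [:: x; y] * z v.1 v.2 = z v.1 v.2 * monomial [:: x; y].
  by case/orP: adj => /commuting_adjointP.
rewrite -[in LHS](cat1s x) -(cat1s y) -(cat1s v) catA catA.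
rewrite monomial_cat [monomial (_ ++ _)]monomial_cat monomial1 comm -mulrA.
by rewrite -monomial_cat -monomial_cons.
Qed.

Lemma rewrite_wordP w p :
  rewrite_word w = Some p -> monomial w = \sum_(v <- p) monomial v.
Proof.
elim: w p => [|x w IHw] p //; rewrite /rewrite_word -/rewrite_word.
case E: (redex (x :: w)) => [q|]; first by move=> [<-]; apply: redexP.
case E': (rewrite_word w) => [q|] //= [<-].
rewrite big_map monomial_cons (IHw _ E') mulr_sumr.
by apply: eq_bigr => v _; rewrite monomial_cons.
Qed.

Lemma normalizeP n p :
  \sum_(w <- normalize n p) monomial w = \sum_(w <- p) monomial w.
Proof.
elim: n p => //= n IHn p; rewrite IHn big_flatten big_map.
apply: eq_bigr => w _; case E: (rewrite_word w) => [q|] /=.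
  by rewrite (rewrite_wordP E).
by rewrite big_seq1.
Qed.

End Monomials.

(** * The relations hold for the comultiplied generators *)

Definition tmul (p q : seq (word * word)) : seq (word * word) :=
  [seq (u.1 ++ v.1, u.2 ++ v.2) | u <- p, v <- q].

Definition comul (x : gen) : seq (word * word) :=
  [seq ([:: (x.1, k)], [:: (k, x.2)])
     | k : 'I_3 <- [:: i1; i2; i3] & (minn x.1 x.2 <= k <= maxn x.1 x.2)%N].

Definition comul_adjoint (x : gen) : seq (word * word) :=
  [seq (adjoint (x.1, k), adjoint (k, x.2))
     | k : 'I_3 <- [:: i1; i2; i3] & (minn x.1 x.2 <= k <= maxn x.1 x.2)%N].

(** The words that occur have at most three letters, and five rounds of
    rewriting bring any such word to normal form. *)
Definition tnormalize (p : seq (word * word)) : seq (word * word) :=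
  flatten
    [seq [seq (u, v) | u <- normalize 5 [:: w.1], v <- normalize 5 [:: w.2]]
       | w <- p].

Definition same_normal_form (p q : seq (word * word)) : bool :=
  perm_eq (tnormalize p) (tnormalize q).

Definition comul_relations_check (i j k l : 'I_3) : bool :=
  let c i j := comul (i, j) in
  let eqn p q := same_normal_form p q in
  [&& (j < l)%N ==> eqn (tmul (c i j) (c i l)) [::],
      (i < k)%N ==> eqn (tmul (c i j) (c k j)) [::],
      (i < k)%N && (j < l)%N ==>
        eqn (tmul (c i l) (c k j)) (tmul (c k j) (c i l)),
      [&& (i < k)%N, (j < l)%N & (minn k l <= maxn i j)%N] ==>
        eqn (tmul (c i l) (c k j)) [::],
      [&& (i < k)%N, (j < l)%N & (maxn i j + 1 < minn k l)%N] ==>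
        eqn (tmul (c i j) (c k l)) (tmul (c k l) (c i j)),
      [&& (i < k)%N, (j < l)%N & (maxn i j + 1 == minn k l)%N] ==>
        eqn (tmul (c i j) (c k l))
            (tmul (c k l) (c i j) ++ tmul (c i l) (c k j))
    & (i != k) && (j != l) ==>
        eqn (tmul (comul_adjoint (i, j)) (c k l))
            (tmul (c k l) (comul_adjoint (i, j)))].

Lemma comul_relations i j k l : comul_relations_check i j k l.
Proof.
pose c := comul_relations_check.
have ok : all3 (fun i => all3 (fun j => all3 (fun k => all3 (c i j k)))).
  by vm_compute.
exact: (all3P (all3P (all3P (all3P ok i) j) k) l).
Qed.

Definition adjoint_comul (x : gen) : seq (word * word) :=
  if adjoint x is [:: y; y'] then tmul (comul y) (comul y') else [::].

Lemma comul_adjointE i j :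
  same_normal_form (comul_adjoint (i, j)) (adjoint_comul (i, j)).
Proof.
pose c i j := same_normal_form (comul_adjoint (i, j)) (adjoint_comul (i, j)).
have ok : all3 (fun i => all3 (c i)) by vm_compute.
exact: (all3P (all3P ok i) j).
Qed.

Section Comultiplication.
Variables (R : realType) (A T : starAlgType R) (z : 'I_3 -> 'I_3 -> A).
Variable t : A -> A -> T.
Hypotheses (zP : A20_relations z) (tP : alg_tensor t).

Definition tensor_eval (p : seq (word * word)) : T :=
  \sum_(w <- p) t (monomial z w.1) (monomial z w.2).

Lemma tnormalizeP p : tensor_eval (tnormalize p) = tensor_eval p.
Proof.
rewrite /tnormalize; move: 5%N => n.
rewrite /tensor_eval big_flatten big_map; apply: eq_bigr => w _.
rewrite big_allpairs (eq_bigr (fun u => t (monomial z u) (monomial z w.2))).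
  by rewrite -(tensor_suml tP) normalizeP // big_seq1.
by move=> u _; rewrite /= -(tensor_sumr tP) normalizeP // big_seq1.
Qed.

Lemma same_normal_formP p q :
  same_normal_form p q -> tensor_eval p = tensor_eval q.
Proof.
by move=> eqpq; rewrite -[LHS]tnormalizeP -[RHS]tnormalizeP; apply: perm_big.
Qed.

Lemma tensor_eval_mul p q :
  tensor_eval (tmul p q) = tensor_eval p * tensor_eval q.
Proof.
case: tP => _ _ tM _ _.
rewrite /tensor_eval big_allpairs_dep /= mulr_suml; apply: eq_bigr => u _.
rewrite mulr_sumr; apply: eq_bigr => v _.
by rewrite !monomial_cat tM.
Qed.

Definition delta (i j : 'I_3) : T :=
  \sum_(k < 3 | (minn i j <= k <= maxn i j)%N) t (z i k) (z k j).

Lemma big_ord3_seq (V : nmodType) (P : pred 'I_3) (F : 'I_3 -> V) :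
  \sum_(k | P k) F k = \sum_(k <- [:: i1; i2; i3] | P k) F k.
Proof.
apply/perm_big/uniq_perm => [|//|i]; first exact: index_enum_uniq.
by rewrite mem_index_enum; apply/esym; move: i; apply: all3P.
Qed.

Lemma comul_delta i j : tensor_eval (comul (i, j)) = delta i j.
Proof.
rewrite /delta big_ord3_seq /tensor_eval big_map big_filter.
by apply: eq_bigr => k _; rewrite !monomial1.
Qed.

Lemma comul_adjoint_delta i j :
  tensor_eval (comul_adjoint (i, j)) = star (delta i j).
Proof.
case: tP => _ _ _ tS _.
rewrite /delta (big_morph _ (@starD _ _) (star0 T)) big_ord3_seq.
rewrite /tensor_eval big_map big_filter.
by apply: eq_bigr => k _; rewrite tS !(star_gen zP (_, _)).
Qed.

Lemma delta_relations : A20_relations delta.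
Proof.
have nilE : tensor_eval [::] = 0 by apply: big_nil.
have catE p q : tensor_eval (p ++ q) = tensor_eval p + tensor_eval q.
  exact: big_cat.
have [_ t11 tM _ _] := tP.
have starE i j : star (delta i j) = tensor_eval (adjoint_comul (i, j)).
  by rewrite -comul_adjoint_delta; apply/same_normal_formP/comul_adjointE.
split.
- move=> i j l lt; have /and5P[/implyP/(_ lt)] := comul_relations i j i l.
  by move/same_normal_formP; rewrite tensor_eval_mul !comul_delta nilE.
- move=> i j k lt; have /and5P[_ /implyP/(_ lt)] := comul_relations i j k j.
  by move/same_normal_formP; rewrite tensor_eval_mul !comul_delta nilE.
- move=> i j k l ik jl; have := comul_relations i j k l.
  rewrite /comul_relations_check ik jl /=.
  move=> /and3P[_ _ /andP[/same_normal_formP]].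
  by rewrite !tensor_eval_mul !comul_delta.
- move=> i j k l ik jl le; have := comul_relations i j k l.
  rewrite /comul_relations_check ik jl le /=.
  move=> /and3P[_ _ /and3P[_ /same_normal_formP]].
  by rewrite !tensor_eval_mul !comul_delta nilE.
- move=> i j k l ik jl lt; have := comul_relations i j k l.
  rewrite /comul_relations_check ik jl lt /=.
  move=> /and5P[_ _ _ _ /andP[/same_normal_formP]].
  by rewrite !tensor_eval_mul !comul_delta.
- move=> i j k l ik jl eq1; have := comul_relations i j k l.
  rewrite /comul_relations_check ik jl -eq1 eqxx /=.
  move=> /and5P[_ _ _ _ /and3P[_ /same_normal_formP]].
  by rewrite catE !tensor_eval_mul !comul_delta => -> _; rewrite addrC addKr.
- rewrite /delta !big_ord3_seq !big_cons !big_nil /= !addr0 !tM.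
  by rewrite !(A20_det zP) t11.
1-9: by rewrite starE tensor_eval_mul !comul_delta.
move=> i j k l ik jl; have := comul_relations i j k l.
rewrite /comul_relations_check ik jl /=.
move=> /and5P[_ _ _ _ /and3P[_ _ /same_normal_formP]].
by rewrite !tensor_eval_mul !comul_delta comul_adjoint_delta.
Qed.

End Comultiplication.

(** * The bialgebra *)

Section Universal.
Variable R : realType.

Lemma A20_relations_hom (A B : starAlgType R) (f : A -> B) z :
  star_hom f -> A20_relations z -> A20_relations (fun i j => f (z i j)).
Proof.
move=> fP zP; have fM := star_homM fP.
split.
- by move=> i j l lt; rewrite -fM (A20_row zP _ lt) star_hom0.
- by move=> i j k lt; rewrite -fM (A20_col zP _ lt) star_hom0.
- by move=> i j k l ik jl; rewrite -!fM (A20_cross zP ik jl).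
- by move=> i j k l ik jl le; rewrite -fM (A20_cross0 zP ik jl le) star_hom0.
- by move=> i j k l ik jl lt; rewrite -!fM (A20_diag zP ik jl lt).
- move=> i j k l ik jl eq1.
  by rewrite -!fM -star_homB // (A20_diag1 zP ik jl eq1).
- by rewrite -!fM (A20_det zP) star_hom1.
10: move=> i j r s ir js.
10: by rewrite -(star_homS fP) -!fM (A20_star_comm zP ir js).
all: rewrite -(star_homS fP) -fM; congr f.
all: by case: zP.
Qed.

Lemma is_A20_ext (A B : cstarAlgType R) (z : 'I_3 -> 'I_3 -> A) (f g : A -> B) :
  is_A20 z -> star_hom f -> star_hom g ->
  (forall i j, f (z i j) = g (z i j)) -> f =1 g.
Proof.
move=> [zP univ] fP gP fg x.
have [h [_ hU]] := univ B _ (A20_relations_hom fP zP).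
have <- : h = f by apply: hU.
by have <- : h = g by apply: hU; split=> // i j; rewrite fg.
Qed.

Lemma counit_relations : A20_relations (fun i j : 'I_3 => (i == j)%:R : R[i]^o).
Proof.
have st (b : bool) : star (b%:R : R[i]^o) = b%:R by apply: conjc_nat.
have nM (b c : bool) : b%:R * c%:R = (b && c)%:R :> R[i]^o.
  by rewrite -natrM mulnb.
have cross0 (i j k l : 'I_3) : (i < k)%N -> (j < l)%N ->
    (i == l) && (k == j) = false.
  by move=> ik jl; apply/negP => /andP[/eqP il /eqP kj]; subst; lia.
split.
- move=> i j l lt; rewrite nM (_ : _ && _ = false) //.
  by apply/negP => /andP[/eqP ij /eqP il]; subst; lia.
- move=> i j k lt; rewrite nM (_ : _ && _ = false) //.
  by apply/negP => /andP[/eqP ij /eqP kj]; subst; lia.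
- by move=> *; rewrite mulrC.
- by move=> i j k l ik jl _; rewrite nM cross0.
- by move=> *; rewrite mulrC.
- by move=> i j k l ik jl _; rewrite mulrC subrr nM cross0.
- by rewrite !nM.
10: by move=> *; rewrite mulrC.
all: by rewrite st nM.
Qed.

End Universal.

Theorem proposition3p2p3 (R : realType)
  (A : cstarAlgType R) (z : 'I_3 -> 'I_3 -> A) (hA : is_A20 z)
  (T : cstarTensor A A) (TL : cstarTensor T A) (TR : cstarTensor A T) :
  exists (D : A -> T) (e : A -> R[i]^o),
    [/\ forall i j : 'I_3,
          D (z i j) =
            \sum_(k < 3 | (minn i j <= k <= maxn i j)%N)
              tensor T (z i k) (z k j),
        forall i j : 'I_3, e (z i j) = (i == j)%:R
      & cstar_bialgebra TL TR D e].
Proof.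
have [zP univ] := hA.
have [D [[DP Dz] _]] := univ T _ (delta_relations zP (tensor_alg_tensor T)).
have [e [[eP ez] _]] := univ (R[i]^o : cstarAlgType R) _ (counit_relations R).
have [DL DLP] := tensor_hom_exists T TL DP (star_hom_id A).
have [DR DRP] := tensor_hom_exists T TR (star_hom_id A) DP.
have [h hP] := assoc_bijective TL TR.
(* The counit as a map into the scalars of A, which are central. *)
have scalP : star_hom (fun a => (e a : R[i]) *: (1 : A)).
  split=> [c x y| |x].
  - by rewrite (star_homD eP) (star_homZ _ _ eP) scalerDl scalerA.
  - split=> [|x y]; first by rewrite (star_hom1 eP) scale1r.
    by rewrite (star_homM eP) -scalerAl mul1r scalerA.
  - by rewrite (star_homS eP) starZ star1.
have scalC a b : e a *: (1 : A) * b = b * (e a *: 1).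
  by rewrite -scalerAl -scalerAr mul1r mulr1.
have [l [lP lE]] := tensor_lift T scalP (star_hom_id A) scalC.
have [r [rP rE]] :=
  tensor_lift T (star_hom_id A) scalP (fun a b => esym (scalC b a)).
have {}lE a b : l (tensor T a b) = (e a : R[i]) *: b.
  by rewrite lE -scalerAl mul1r.
have {}rE a b : r (tensor T a b) = (e b : R[i]) *: a.
  by rewrite rE -scalerAr mulr1.
exists D, e; split=> //; split=> //.
  exists DL, DR, h; split=> // x.
  have [[DLh DLE] [DRh DRE] [hh _ hE]] := And3 DLP DRP hP.
  apply: (is_A20_ext hA (star_hom_comp (star_hom_comp DP DLh) hh)
                        (star_hom_comp DP DRh)) => i j /=.
  have sum_tR a b : DR (tensor T (z i a) (z a b)) =
      \sum_(k < 3 | (minn a b <= k <= maxn a b)%N)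
        tensor TR (z i a) (tensor T (z a k) (z k b)).
    by rewrite DRE Dz (tensor_sumr (tensor_alg_tensor TR)).
  have sum_tL b : h (DL (tensor T (z i b) (z b j))) =
      \sum_(k < 3 | (minn i b <= k <= maxn i b)%N)
        tensor TR (z i k) (tensor T (z k b) (z b j)).
    rewrite DLE Dz (tensor_suml (tensor_alg_tensor TL)) star_hom_sum //.
    by apply: eq_bigr => k _; rewrite hE.
  rewrite Dz !star_hom_sum // (eq_bigr _ (fun k _ => sum_tL k)).
  rewrite [RHS](eq_bigr _ (fun k _ => sum_tR k j)).
  rewrite (exchange_big_dep (fun k : 'I_3 => minn i j <= k <= maxn i j)%N) /=.
    by apply: eq_bigr => k kij; apply: eq_bigl => b; lia.
  by move=> b k; lia.
exists l, r; split=> // [x|x].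
  apply: (is_A20_ext hA (star_hom_comp DP lP) (star_hom_id A)) => i j /=.
  rewrite Dz star_hom_sum // (bigD1 i) ?geq_minl ?leq_maxl //= big1.
    by rewrite lE ez eqxx scale1r addr0.
  by move=> k /andP[_ ki]; rewrite lE ez eq_sym (negPf ki) scale0r.
apply: (is_A20_ext hA (star_hom_comp DP rP) (star_hom_id A)) => i j /=.
rewrite Dz star_hom_sum // (bigD1 j) ?geq_minr ?leq_maxr //= big1.
  by rewrite rE ez eqxx scale1r addr0.
by move=> k /andP[_ kj]; rewrite rE ez (negPf kj) scale0r.
Qed.
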